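(* Let $\mu$ be a non-atomic Borel probability measure on $[0,1]$ with $0,1\in\operatorname{supp}(\mu)$ and distribution function $F$, and let $(\mu_n)_{n\in\mathbb{N}}$ be a sequence of non-atomic Borel probability measures on $[0,1]$ with $0,1\in\operatorname{supp}(\mu_n)$ and distribution functions $F_n$, such that $\mu_n$ converges weakly to $\mu$ as $n\to\infty$. Let $z\in\mathbb{R}$, let $\cosh_z,\sinh_z$ be the generalized hyperbolic functions defined by $\mu$, and $\cosh_{z,n},\sinh_{z,n}$ those defined by $\mu_n$. Then, for every $n\in\mathbb{N}$, $$\left\lVert\cosh_z-\cosh_{z,n}\right\rVert_\infty\le 2z^2e^{z^2}\left\lVert F-F_n\right\rVert_\infty,$$ $$\left\lVert\cosh_z'-\cosh_{z,n}'\right\rVert_\infty\le\left(z^2+2z^4e^{z^2}\right)\left\lVert F-F_n\right\rVert_\infty,$$ $$\left\lVert\sinh_z-\sinh_{z,n}\right\rVert_\infty\le 2|z|^3e^{z^2}\left\lVert F-F_n\right\rVert_\infty.$$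
   Context: Here $\lVert\cdot\rVert_\infty$ is the sup norm on $[0,1]$. For a non-atomic Borel probability measure $\nu$ on $[0,1]$, set $p_0(x)=q_0(x)=1$ for $x\in[0,1]$ and recursively for $k\ge1$: $p_k(x)=\int_0^x p_{k-1}(t)\,d\nu(t)$ if $k$ is odd, $p_k(x)=\int_0^x p_{k-1}(t)\,dt$ if $k$ is even; $q_k(x)=\int_0^x q_{k-1}(t)\,dt$ if $k$ is odd, $q_k(x)=\int_0^x q_{k-1}(t)\,d\nu(t)$ if $k$ is even. The generalized hyperbolic functions defined by $\nu$ are, for $x\in[0,1]$ and $z\in\mathbb{R}$, $$\sinh_z(x)=\sum_{k=0}^\infty z^{2k+1}q_{2k+1}(x),\qquad\cosh_z(x)=\sum_{k=0}^\infty z^{2k}p_{2k}(x).$$ The prime denotes the derivative in $x$. *)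

(* Defs.v *)
From HB Require Import structures.
From mathcomp Require Import all_boot all_order all_algebra.
From mathcomp Require Import all_classical all_reals all_analysis.
Set Implicit Arguments.
Unset Strict Implicit.
Unset Printing Implicit Defensive.
Import Order.TTheory GRing.Theory Num.Theory.
Import numFieldNormedType.Exports.
Local Open Scope classical_set_scope.
Local Open Scope ring_scope.

(* A Borel probability measure on [0, 1] is encoded as a Borel probability
   measure nu on R satisfying nu `[0, 1] = 1 (hypothesis carried_by01). *)
Notation borel_prob R := (probability (measurableTypeR R) R).

Section Measures.
Variables (R : realType).
Implicit Type nu : borel_prob R.

Definition carried_by01 nu : Prop := nu `[0, 1]%classic = 1%E.

(* An atom is a measurable set of positive measure none of whose measurable
   subsets has strictly intermediate measure. *)
Definition nonatomic nu : Prop :=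
  forall A : set (measurableTypeR R), measurable A -> (0 < nu A)%E ->
  exists B : set (measurableTypeR R),
    [/\ measurable B, B `<=` A & (0 < nu B < nu A)%E].

Definition measure_support nu : set R :=
  [set x | forall U : set R, open U -> U x -> (0 < nu U)%E].

Definition distribution_function nu (x : R) : R := fine (nu `[0, x]%classic).

(* The test functions are the elements of C([0, 1]); they are automatically
   bounded, and their values outside [0, 1] are irrelevant. *)
Definition weakly_converges01 (nus : nat -> borel_prob R) nu : Prop :=
  forall f : R -> R, {within `[0, 1], continuous f} ->
    (\int[nus n]_(x in `[0, 1]) f x) @[n --> \oo] -->
      \int[nu]_(x in `[0, 1]) f x.

End Measures.

Section Hyperbolic.
Variables (R : realType) (nu : borel_prob R).

Fixpoint hyp_p (k : nat) (x : R) : R :=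
  match k with
  | 0%N => 1
  | k'.+1 => if odd k then \int[nu]_(t in `[0, x]) hyp_p k' t
             else \int[lebesgue_measure]_(t in `[0, x]) hyp_p k' t
  end.

Fixpoint hyp_q (k : nat) (x : R) : R :=
  match k with
  | 0%N => 1
  | k'.+1 => if odd k then \int[lebesgue_measure]_(t in `[0, x]) hyp_q k' t
             else \int[nu]_(t in `[0, x]) hyp_q k' t
  end.

Definition gsinh (z x : R) : R :=
  limn (series (fun k : nat => z ^+ (2 * k + 1) * hyp_q (2 * k + 1) x)).

Definition gcosh (z x : R) : R :=
  limn (series (fun k : nat => z ^+ (2 * k) * hyp_p (2 * k) x)).

End Hyperbolic.

Section Interval01.
Variable R : realType.
Implicit Type f : R -> R.

(* Derivative of a function on [0, 1]: only points of [0, 1] enter the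
   difference quotient, so it is one-sided at 0 and at 1. *)
Definition derive01 f (x : R) : R :=
  lim ((f y - f x) / (y - x) @[y --> within `[0, 1]%classic x^']).

(* Extended-real valued, so that the norm of an unbounded function is +oo
   rather than a default value. *)
Definition sup_norm01 f : \bar R :=
  ereal_sup [set (`|f x|)%:E | x in `[0, 1]%classic].

End Interval01.

(* Main.v *)
Require Import Defs.
From HB Require Import structures.
From mathcomp Require Import all_boot all_order all_algebra.
From mathcomp Require Import all_classical all_reals all_analysis.
From mathcomp Require Import measurable_realfun.
From mathcomp Require Import ring lra.
Import Order.TTheory GRing.Theory Num.Theory.
Import numFieldNormedType.Exports.
Local Open Scope classical_set_scope.
Local Open Scope ring_scope.
Set Implicit Arguments.
Unset Strict Implicit.
Unset Printing Implicit Defensive.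

(** Write [F] and [F'] for the distribution functions of the two measures and [D]
    for the sup norm of [F - F']. Everything rests on a recursion that involves
    only Lebesgue integrals. Integration by parts (lemma [primitive_by_parts],
    that is Tonelli's theorem on a triangle) shows that integrating a function [h]
    against [dt] and then against the measure gives
    [\int_0^x h s * (F x - F s) ds]. Hence the functions [hyp_p (2 * k).+1] and
    [hyp_q (2 * k)] are the iterates of the same Volterra operator, starting from
    [F] and from [1] respectively; apart from the constant [hyp_p 0], the remaining
    functions are their primitives.

    Since the kernel lies in [0, 1], the [k]-th iterate at [x] is at most
    [x ^+ k / k`!]. When [F] is replaced by [F'], the kernel moves by at most
    [2 * D], so each step adds [2 * D] to the coefficient of [x ^+ k / k`!] in the
    bound on the difference of the iterates (lemma [volterra_dist]): it is at most
    [2 * k * D] for [hyp_q (2 * k)] and, when [0 < k], for [hyp_p (2 * k).+1].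
    In the latter case the initial error is already [D], so the first step needs
    the sharper estimate [volterra_self_dist]: the difference of [a * (b - a)] and
    [a' * (b' - a')], for points of the triangle [0 <= a <= b <= 1] with
    coordinates at distance at most [D], is at most [2 * D].
    Summing over [k] against the powers of [z] gives the three estimates.

    The derivative of [gcosh] is the termwise one. Increments of [gcosh] between
    [x] and [y] lie between [y - x] times the values at [x] and at [y] of the
    termwise derivative [gcosh_deriv], because all its terms are nondecreasing;
    and [gcosh_deriv] is continuous because its increments are dominated by those
    of [F], which is continuous as the measure has no atoms. *)

(** * Nonnegative nondecreasing functions and iterated integrals *)

(** The class of nonnegative nondecreasing functions on [0, 1], which contains all
    the iterated integrals. Membership already gives measurability and
    boundedness on [0, 1]; values outside [0, 1] are unconstrained. *)
Definition monotone01 (R : realType) (h : R -> R) : Prop :=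
  0 <= h 0 /\ forall x y : R, 0 <= x -> x <= y -> y <= 1 -> h x <= h y.

Lemma monotone01_ge0 (R : realType) (h : R -> R) (x : R) :
  monotone01 h -> 0 <= x -> x <= 1 -> 0 <= h x.
Proof. by move=> [h0 hm] x0 x1; apply: le_trans h0 (hm _ _ _ x0 x1). Qed.

Lemma itv_sub01 (R : realType) (x : R) : x <= 1 -> `[0, x] `<=` `[0, 1].
Proof.
by move=> x1 t /=; rewrite !in_itv/= => /andP[-> /le_trans]; apply.
Qed.

Lemma monotone01_measurable (R : realType) (h : R -> R) :
  monotone01 h -> measurable_fun (`[0, 1]%classic : set (measurableTypeR R)) h.
Proof.
(* Clamping the argument to [0, 1] extends [h] to a monotone function on R. *)
move=> [h0 hm]; pose g x := h (Num.min (Num.max x 0) 1).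
have /(@nondecreasing_measurable R `[0, 1]) : {homo g : x y / x <= y}.
  move=> x y xy; apply: hm.
  - by rewrite le_min le_max lexx orbT ler01.
  - by rewrite le_min2// le_max2.
  - by rewrite ge_min lexx orbT.
move=> mg; apply: eq_measurable_fun (mg (measurable_itv _)) => x.
rewrite inE/= in_itv/= => /andP[x0 x1].
by rewrite /g max_l// min_l.
Qed.

Section finite_measure_on_unit_interval.
Variables (R : realType) (m : {measure set (measurableTypeR R) -> \bar R}).
Hypothesis mfin : (m `[0%R, 1%R]%classic < +oo)%E.

Lemma measure_sub01 (A : set (measurableTypeR R)) :
  measurable A -> A `<=` `[0, 1] -> (m A < +oo)%E.
Proof.
move=> mA A01; apply: le_lt_trans mfin; apply: le_measure; rewrite ?inE//.
Qed.

Lemma bounded_integrable (A : set (measurableTypeR R)) (h : R -> R) (c : R) :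
  measurable A -> A `<=` `[0, 1] -> measurable_fun A h ->
  (forall x, A x -> `|h x| <= c) -> m.-integrable A (EFin \o h).
Proof.
move=> mA A01 mh hc; apply: measurable_bounded_integrable => //.
  exact: measure_sub01.
exists c; split; first exact: num_real.
by move=> M cM x Ax /=; apply: le_trans (hc _ Ax) (ltW cM).
Qed.

Lemma monotone01_integrable (A : set (measurableTypeR R)) (h : R -> R) :
  measurable A -> A `<=` `[0, 1] -> monotone01 h ->
  m.-integrable A (EFin \o h).
Proof.
move=> mA A01 hm; apply: (@bounded_integrable _ _ (h 1)) => //.
  apply: measurable_funS (monotone01_measurable hm) => //.
move=> x /A01; rewrite /= in_itv/= => /andP[x0 x1].
by rewrite ger0_norm ?(hm.2)// monotone01_ge0.
Qed.

(** Valid for both integrators, Lebesgue measure and [nu]. It gives the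
    monotonicity of primitives, compares the increments of the [hyp_p] of odd
    index with those of the distribution function, and yields the difference
    quotients of [gcosh]. *)
Lemma monotone01_increment (h : R -> R) (x y : R) : monotone01 h ->
  0 <= x -> x <= y -> y <= 1 ->
  h x * fine (m `]x, y]%classic)
    <= \int[m]_(t in `[0, y]) h t - \int[m]_(t in `[0, x]) h t
    <= h y * fine (m `]x, y]%classic).
Proof.
move=> hm x0 xy y1.
have xy01 : `]x, y] `<=` `[0, 1].
  move=> t /=; rewrite !in_itv/= => /andP[xt ty].
  by rewrite (le_trans x0 (ltW xt)) (le_trans ty y1).
have -> : `[0, y]%classic = `[0, x]%classic `|` `]x, y]%classic.
  by apply: itv_bndbnd_setU; rewrite bnd_simp.
rewrite Rintegral_setU ?measurable_itv//; last first.
- apply/disj_setPS => t [/=]; rewrite !in_itv/= => /andP[_ tx] /andP[].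
  by rewrite ltNge tx.
- apply: monotone01_integrable => //; first exact: measurableU.
  rewrite subUset; split=> //; apply: itv_sub01; exact: le_trans y1.
rewrite addrAC subrr add0r -!Rintegral_cst//.
have ci (c : R) : m.-integrable `]x, y] (EFin \o cst c).
  apply: (@bounded_integrable _ _ `|c|) => //.
have hi : m.-integrable `]x, y] (EFin \o h) by apply: monotone01_integrable.
apply/andP; split; apply: le_Rintegral => //;
  [exact: ci| |exact: ci|] => t /=; rewrite in_itv/= => /andP[xt ty];
  apply: hm.2 => //.
- exact: ltW.
- exact: le_trans y1.
- by rewrite (le_trans x0)// ltW.
Qed.

Lemma monotone01_primitive (h : R -> R) : monotone01 h ->
  monotone01 (fun x => \int[m]_(t in `[0, x]) h t).
Proof.
move=> hm; split.
  apply: Rintegral_ge0 => t /=; rewrite in_itv/= => /andP[t0 t1].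
  by rewrite monotone01_ge0// (le_trans t1).
move=> x y x0 xy y1; rewrite -subr_ge0.
have /andP[+ _] := monotone01_increment hm x0 xy y1; apply: le_trans.
apply: mulr_ge0; last by rewrite fine_ge0.
by apply: monotone01_ge0; rewrite // (le_trans xy).
Qed.

End finite_measure_on_unit_interval.

Lemma lebesgue_fin01 (R : realType) :
  (@lebesgue_measure R `[0%R, 1%R]%classic < +oo)%E.
Proof. by rewrite lebesgue_measure_itv/= lte_fin ltr01 -EFinB ltry. Qed.

Lemma prob_fin01 (R : realType) (nu : probability (measurableTypeR R) R) :
  (nu `[0%R, 1%R]%classic < +oo)%E.
Proof. by rewrite (le_lt_trans (probability_le1 _ _)) ?ltry//. Qed.

Section monotone_hyp.
Variables (R : realType) (nu : probability (measurableTypeR R) R).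

Lemma monotone01_1 : monotone01 (fun _ : R => 1 : R).
Proof. by split=> //; exact: ler01. Qed.

Lemma hyp_p_oddE (k : nat) : odd k.+1 ->
  hyp_p nu k.+1 = fun x => \int[nu]_(t in `[0, x]) hyp_p nu k t.
Proof. by move=> ok; apply/funext => x; rewrite [LHS]/= -[~~ _]/(odd k.+1) ok. Qed.

Lemma hyp_p_evenE (k : nat) : ~~ odd k.+1 ->
  hyp_p nu k.+1 = fun x => \int[lebesgue_measure]_(t in `[0, x]) hyp_p nu k t.
Proof.
by move=> /negbTE ok; apply/funext => x; rewrite [LHS]/= -[~~ _]/(odd k.+1) ok.
Qed.

Lemma hyp_q_oddE (k : nat) : odd k.+1 ->
  hyp_q nu k.+1 = fun x => \int[lebesgue_measure]_(t in `[0, x]) hyp_q nu k t.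
Proof. by move=> ok; apply/funext => x; rewrite [LHS]/= -[~~ _]/(odd k.+1) ok. Qed.

Lemma hyp_q_evenE (k : nat) : ~~ odd k.+1 ->
  hyp_q nu k.+1 = fun x => \int[nu]_(t in `[0, x]) hyp_q nu k t.
Proof.
by move=> /negbTE ok; apply/funext => x; rewrite [LHS]/= -[~~ _]/(odd k.+1) ok.
Qed.

Lemma hyp_p_monotone (k : nat) : monotone01 (hyp_p nu k).
Proof.
elim: k => [|k IH]; first exact: monotone01_1.
have [ok|ok] := boolP (odd k.+1).
  rewrite hyp_p_oddE//; apply: monotone01_primitive IH; exact: prob_fin01.
rewrite hyp_p_evenE//; apply: monotone01_primitive IH; exact: lebesgue_fin01.
Qed.

Lemma hyp_q_monotone (k : nat) : monotone01 (hyp_q nu k).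
Proof.
elim: k => [|k IH]; first exact: monotone01_1.
have [ok|ok] := boolP (odd k.+1).
  rewrite hyp_q_oddE//; apply: monotone01_primitive IH; exact: lebesgue_fin01.
rewrite hyp_q_evenE//; apply: monotone01_primitive IH; exact: prob_fin01.
Qed.

End monotone_hyp.

(** * Distribution functions and integration by parts *)

Lemma nonatomic_set1 (R : realType) (nu : probability (measurableTypeR R) R)
  (x : R) : nonatomic nu -> nu [set x] = 0%E.
Proof.
move=> na; apply/eqP; rewrite eq_le measure_ge0 andbT leNgt; apply/negP => nx.
have [B [mB Bx /andP[B0 Bn]]] := na _ (measurable_set1 x) nx.
have [BE|BE] := pselect (B x).
  move: Bn; suff -> : B = [set x] by rewrite ltxx.
  by apply/seteqP; split=> // _ ->.
move: B0; suff -> : B = set0 by rewrite measure0 ltxx.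
by apply/seteqP; split=> // y By; move: BE; rewrite -(Bx _ By).
Qed.

Section distribution.
Variables (R : realType) (nu : probability (measurableTypeR R) R).
Notation F := (distribution_function nu).

(** The distribution function is the first iterated integral. *)
Lemma distribution_hyp_p : F = hyp_p nu 1.
Proof.
by apply/funext => x; rewrite hyp_p_oddE//= Rintegral_cst ?mul1r// measurable_itv.
Qed.

Lemma distribution_monotone : monotone01 F.
Proof. by rewrite distribution_hyp_p; exact: hyp_p_monotone. Qed.

Lemma distribution_le1 (x : R) : F x <= 1.
Proof.
rewrite /distribution_function -lee_fin fineK ?probability_le1//.
exact: fin_num_measure.
Qed.

Lemma distribution_increment (x y : R) : 0 <= x -> x <= y -> y <= 1 ->
  F y - F x = fine (nu `]x, y]%classic).
Proof.
move=> x0 xy y1; have := monotone01_increment (prob_fin01 nu) (monotone01_1 R) x0 xy y1.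
rewrite !mul1r => H; apply/eqP; rewrite eq_le andbC.
by move: H; rewrite distribution_hyp_p hyp_p_oddE.
Qed.

Hypothesis nu_na : nonatomic nu.

Lemma distribution_incrementE (x y : R) : 0 <= x -> x <= y -> y <= 1 ->
  nu `[x, y]%classic = (F y - F x)%:E.
Proof.
move=> x0 xy y1; rewrite distribution_increment// fineK; last exact: fin_num_measure.
rewrite (@itv_bndbnd_setU _ _ _ (BRight x)) ?bnd_simp// measureU//; last first.
  apply/seteqP; split => t //= []; rewrite !in_itv/= => /andP[_ tx] /andP[].
  by rewrite ltNge tx.
by rewrite set_itv1 [X in (X + _)%E](nonatomic_set1 x nu_na) add0e.
Qed.

(** Integration by parts against [nu]. Both sides are the integral of [h s] over
    the triangle [0 <= s <= t <= x], for the product of [nu (dt)] and [ds];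
    non-atomicity turns the mass of the section [[s, x]] into [F x - F s]. *)
Lemma primitive_by_parts (h : R -> R) (x : R) : monotone01 h -> x <= 1 ->
  \int[nu]_(t in `[0, x]) \int[lebesgue_measure]_(s in `[0, t]) h s
  = \int[lebesgue_measure]_(s in `[0, x]) (h s * (F x - F s)).
Proof.
move=> hm x1.
pose E := [set p : measurableTypeR R * measurableTypeR R |
  [&& 0 <= p.2, p.2 <= p.1 & p.1 <= x]].
have mE : measurable E.
  rewrite (_ : E = setT `&` (fun p : measurableTypeR R * measurableTypeR R =>
    [&& 0 <= p.2, p.2 <= p.1 & p.1 <= x]) @^-1` [set true]); last first.
    by rewrite setTI.
  suff mb : measurable_fun setT (fun p : measurableTypeR R * measurableTypeR R =>
    [&& 0 <= p.2, p.2 <= p.1 & p.1 <= x]) by exact: mb.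
  apply: measurable_and; first exact: measurable_fun_ler.
  by apply: measurable_and; exact: measurable_fun_ler.
have E01 p : E p -> `[0, 1]%classic p.2.
  rewrite /E/= in_itv/= => /and3P[-> st tx]/=.
  by rewrite (le_trans st)// (le_trans tx).
pose f := EFin \o ((fun p : measurableTypeR R * measurableTypeR R => h p.2) \_ E).
have mf : measurable_fun setT f.
  apply/measurable_EFinP; apply/(measurable_restrictT _ mE).
  apply: (measurable_comp _ _ (monotone01_measurable hm)) => //.
    by move=> _ [p /E01 + <-].
  exact: measurable_funS measurable_snd.
have f0 p : (0 <= f p)%E.
  rewrite /f/= lee_fin patchE; case: ifPn => //; rewrite inE => /E01.
  by rewrite /= in_itv/= => /andP[? ?]; exact: monotone01_ge0.
have := fubini_tonelli (m1 := nu) (m2 := lebesgue_measure) f mf f0.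
(* Sections of [E] at fixed [t] are [0, t]. *)
have -> : (\int[nu]_t \int[lebesgue_measure]_s f (t, s) =
  \int[nu]_(t in `[0%R, x]%classic)
    (\int[lebesgue_measure]_(s in `[0, t]) h s)%:E)%E.
  rewrite [RHS]integral_mkcond; apply: eq_integral => t _.
  rewrite patchE; case: ifPn => [|tx].
    rewrite inE/= in_itv/= => /andP[t0 tx].
    rewrite /Rintegral fineK; last first.
      apply: integrable_fin_num => //.
      apply: monotone01_integrable => //; first exact: lebesgue_fin01.
      by apply: itv_sub01; rewrite (le_trans tx).
    rewrite [RHS]integral_mkcond; apply: eq_integral => s _.
    rewrite /f/= !patchE; have -> : ((t, s) \in E) = (s \in `[0, t]%classic).
      by apply/idP/idP; rewrite !inE /E/= in_itv/= tx andbT.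
    by case: ifP.
  rewrite integral0_eq// => s _; rewrite /f/= patchE ifF//.
  apply: contraNF tx; rewrite !inE /E/= in_itv/= => /and3P[s0 st ->].
  by rewrite (le_trans s0).
(* Sections of [E] at fixed [s] are [s, x]. *)
have -> : (\int[lebesgue_measure]_s \int[nu]_t f (t, s) =
  \int[lebesgue_measure]_(s in `[0%R, x]%classic) (h s * (F x - F s))%:E)%E.
  rewrite [RHS]integral_mkcond; apply: eq_integral => s _.
  rewrite patchE; case: ifPn => [|sx].
    rewrite inE/= in_itv/= => /andP[s0 sx].
    rewrite EFinM -distribution_incrementE// -integral_cst//.
    rewrite [RHS]integral_mkcond; apply: eq_integral => t _.
    rewrite /f/= !patchE; have -> : ((t, s) \in E) = (t \in `[s, x]%classic).
      by apply/idP/idP; rewrite !inE /E/= in_itv/= s0.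
    by case: ifP.
  rewrite integral0_eq// => t _; rewrite /f/= patchE ifF//.
  apply: contraNF sx; rewrite !inE /E/= in_itv/= => /and3P[-> st tx].
  by rewrite (le_trans st).
by rewrite /Rintegral => ->.
Qed.

End distribution.

(** * Volterra operators and their perturbation *)

Notation leb := lebesgue_measure.

Lemma monotone01_le1 (R : realType) (F : R -> R) (x : R) :
  monotone01 F -> F 1 <= 1 -> 0 <= x -> x <= 1 -> F x <= 1.
Proof. by move=> [_ Fm] F1 x0 x1; apply: le_trans F1; apply: Fm. Qed.

Lemma monotone01_increment_le1 (R : realType) (F : R -> R) (s x : R) :
  monotone01 F -> F 1 <= 1 -> 0 <= s -> s <= x -> x <= 1 ->
  `|F x - F s| <= 1.
Proof.
move=> Fm F1 s0 sx x1; rewrite ger0_norm ?subr_ge0 ?Fm.2// lerBlDr.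
have x0 := le_trans s0 sx.
rewrite (le_trans (monotone01_le1 Fm F1 x0 x1))// lerDl.
exact: monotone01_ge0 Fm s0 (le_trans sx x1).
Qed.

Section volterra.
Variable R : realType.
Implicit Types (h F : R -> R) (x : R).

Lemma exp_coeff_le (k : nat) x : 0 <= x -> x <= 1 ->
  exp_coeff x k <= k`!%:R^-1.
Proof.
move=> x0 x1; rewrite /exp_coeff/= ler_piMl ?invr_ge0// exprn_ile1//.
Qed.

Lemma exp_coeffS (k : nat) x : k.+1%:R * exp_coeff x k.+1 = x * exp_coeff x k.
Proof.
rewrite /exp_coeff/= factS natrM exprS; field.
by rewrite ?pnatr_eq0 -?lt0n ?fact_gt0 /=.
Qed.

Lemma exp_coeff_continuous (k : nat) : continuous (fun x => exp_coeff x k).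
Proof.
by move=> x; apply: cvgM; [exact: exprn_continuous|exact: cvg_cst].
Qed.

Lemma is_derive_exp_coeff (k : nat) x :
  is_derive x 1 (fun y : R => exp_coeff y k.+1) (exp_coeff x k).
Proof.
have -> : (fun y : R => exp_coeff y k.+1) = (k.+1)`!%:R^-1 *: (@id R ^+ k.+1).
  by apply/funext => y; rewrite /exp_coeff [LHS]/= mulrC exprfctE.
apply: is_derive_eq.
rewrite /exp_coeff /GRing.scale/= mulr1 factS natrM; field.
by rewrite nat1r !pnatr_eq0 -!lt0n fact_gt0.
Qed.

Lemma Rintegral_exp_coeff (k : nat) x : 0 <= x ->
  \int[leb]_(s in `[0, x]) exp_coeff s k = exp_coeff x k.+1.
Proof.
rewrite le_eqVlt => /predU1P[<-|x0].
  by rewrite set_itv1 Rintegral_set1 /exp_coeff/= expr0n mul0r.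
rewrite /Rintegral (@continuous_FTC2 _ _ (fun s => exp_coeff s k.+1))//.
- by rewrite /exp_coeff/= expr0n mul0r subr0.
- by apply: continuous_subspaceT; exact: exp_coeff_continuous.
- split.
  + by move=> y _; have [] := is_derive_exp_coeff k y.
  + by apply: cvg_at_right_filter; exact: exp_coeff_continuous.
  + by apply: cvg_at_left_filter; exact: exp_coeff_continuous.
- move=> y _; rewrite derive1E; have := is_derive_exp_coeff k y => H.
  by rewrite derive_val.
Qed.

(** The one-step estimate behind all the inductions: integration raises the index
    of the bound [exp_coeff s k = s ^+ k / k`!] by one. *)
Lemma Rintegral_norm_le_exp_coeff (f : R -> R) (c : R) (k : nat) x :
  0 <= x -> x <= 1 -> measurable_fun (`[0, x]%classic : set (measurableTypeR R)) f ->
  (forall s : R, 0 <= s -> s <= x -> `|f s| <= c * exp_coeff s k) ->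
  `|\int[leb]_(s in `[0, x]) f s| <= c * exp_coeff x k.+1.
Proof.
move=> x0 x1 mf fc.
have i01 := itv_sub01 x1.
have mx : measurable (`[0, x]%classic : set (measurableTypeR R)).
  exact: measurable_itv.
have ie : (@lebesgue_measure R).-integrable `[0, x] (EFin \o (fun s => exp_coeff s k)).
  apply: (@bounded_integrable _ _ (lebesgue_fin01 R) _ _ 1) => //.
    apply: measurable_funTS; apply: continuous_measurable_fun.
    exact: exp_coeff_continuous.
  move=> s /i01; rewrite /= in_itv/= => /andP[s0 s1].
  rewrite ger0_norm ?exp_coeff_ge0// (le_trans (exp_coeff_le _ s0 s1))//.
  by rewrite invf_le1 ?ltr0n ?fact_gt0// ler1n fact_gt0.
have fi : (@lebesgue_measure R).-integrable `[0, x] (EFin \o f).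
  apply: (@bounded_integrable _ _ (lebesgue_fin01 R) _ _ `|c|) => //.
  move=> s /[dup] /i01; rewrite /= !in_itv/= => /andP[_ s1] /andP[s0 sx].
  rewrite (le_trans (fc _ s0 sx))// (le_trans (ler_norm _))// normrM.
  rewrite ler_piMr// ger0_norm ?exp_coeff_ge0// (le_trans (exp_coeff_le _ s0 s1))//.
  by rewrite invf_le1 ?ltr0n ?fact_gt0// ler1n fact_gt0.
rewrite (le_trans (le_normr_Rintegral _ _))//.
rewrite -Rintegral_exp_coeff// -RintegralZl//.
apply: le_Rintegral => //.
- exact: integrable_norm fi.
- have := @integrableZl _ _ _ _ _ mx c _ ie; apply: eq_integrable => //.
by move=> s /=; rewrite in_itv/= => /andP[s0 sx]; apply: fc.
Qed.

Lemma monotone01_primitive_le (h : R -> R) (k : nat) (x : R) :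
  monotone01 h -> 0 <= x -> x <= 1 ->
  (forall s : R, 0 <= s -> s <= 1 -> h s <= exp_coeff s k) ->
  \int[leb]_(s in `[0, x]) h s <= exp_coeff x k.+1.
Proof.
move=> hm x0 x1 hk; rewrite -[leRHS]mul1r (le_trans (ler_norm _))//.
apply: Rintegral_norm_le_exp_coeff => //.
  exact: measurable_funS (itv_sub01 x1) (monotone01_measurable hm).
move=> s s0 sx; have s1 := le_trans sx x1.
by rewrite mul1r ger0_norm ?hk// monotone01_ge0.
Qed.

Lemma primitive_dist (h h' : R -> R) (c : R) (k : nat) (x : R) :
  monotone01 h -> monotone01 h' -> 0 <= x -> x <= 1 ->
  (forall s : R, 0 <= s -> s <= 1 -> `|h s - h' s| <= c * exp_coeff s k) ->
  `|\int[leb]_(s in `[0, x]) h s - \int[leb]_(s in `[0, x]) h' s|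
    <= c * exp_coeff x k.+1.
Proof.
move=> hm h'm x0 x1 hh'; have i01 := itv_sub01 x1.
have mx : measurable (`[0, x]%classic : set (measurableTypeR R)).
  exact: measurable_itv.
have hi (f : R -> R) : monotone01 f ->
    (@lebesgue_measure R).-integrable `[0, x] (EFin \o f).
  by apply: monotone01_integrable => //; exact: lebesgue_fin01.
rewrite -RintegralB; [|exact: mx|exact: hi|exact: hi].
apply: Rintegral_norm_le_exp_coeff => //.
  apply: measurable_funB.
    exact: measurable_funS i01 (monotone01_measurable hm).
  exact: measurable_funS i01 (monotone01_measurable h'm).
by move=> s s0 sx; apply: hh' => //; exact: le_trans x1.
Qed.

(** The Volterra operator with kernel [F x - F s]. By integration by parts it
    takes an iterated integral to the one two steps further that is obtained by
    integrating against [ds] and then against [nu]. *)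
Definition volterra F h x : R :=
  \int[leb]_(s in `[0, x]) (h s * (F x - F s)).

Lemma volterra_measurable F h x : monotone01 F -> monotone01 h -> x <= 1 ->
  measurable_fun (`[0, x]%classic : set (measurableTypeR R))
    (fun s => h s * (F x - F s)).
Proof.
move=> Fm hm x1; apply: measurable_funM; last apply: measurable_funB => //.
  exact: measurable_funS (itv_sub01 x1) (monotone01_measurable hm).
exact: measurable_funS (itv_sub01 x1) (monotone01_measurable Fm).
Qed.

Lemma volterra_integrable F h x : monotone01 F -> monotone01 h -> x <= 1 ->
  (@lebesgue_measure R).-integrable `[0, x] (EFin \o (fun s => h s * (F x - F s))).
Proof.
move=> Fm hm x1.
apply: (@bounded_integrable _ _ (lebesgue_fin01 R) _ _ (h 1 * F 1)).
- exact: measurable_itv.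
- exact: itv_sub01.
- exact: volterra_measurable.
move=> s; rewrite /= in_itv/= => /andP[s0 sx].
have s1 := le_trans sx x1.
rewrite normrM ler_pM//.
  by rewrite ger0_norm ?hm.2// monotone01_ge0.
rewrite ger0_norm ?subr_ge0 ?Fm.2//.
rewrite lerBlDr (le_trans (Fm.2 _ _ _ x1 _)) ?(le_trans s0)// lerDl.
exact: monotone01_ge0.
Qed.

Lemma volterra_le F h (k : nat) x : monotone01 F -> F 1 <= 1 ->
  monotone01 h -> 0 <= x -> x <= 1 ->
  (forall s : R, 0 <= s -> s <= 1 -> h s <= exp_coeff s k) ->
  volterra F h x <= exp_coeff x k.+1.
Proof.
move=> Fm F1 hm x0 x1 hk; rewrite -[leRHS]mul1r (le_trans (ler_norm _))//.
apply: Rintegral_norm_le_exp_coeff => //; first exact: volterra_measurable.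
move=> s s0 sx; have s1 := le_trans sx x1.
rewrite mul1r normrM -[leRHS]mulr1 ler_pM//.
  by rewrite ger0_norm ?hk// monotone01_ge0.
exact: monotone01_increment_le1.
Qed.

Section perturbation.
Variables (F F' : R -> R) (D : R).
Hypotheses (Fm : monotone01 F) (F'm : monotone01 F').
Hypotheses (F1 : F 1 <= 1) (F'1 : F' 1 <= 1).
Hypothesis FD : forall x : R, 0 <= x -> x <= 1 -> `|F x - F' x| <= D.

(** Perturbation of the kernel and of the argument together. The kernel
    [F x - F s] moves by at most [2 * D], whence the increment of the constant. *)
Lemma volterra_dist h h' (a : R) (k : nat) x :
  monotone01 h -> monotone01 h' -> 0 <= x -> x <= 1 ->
  (forall s : R, 0 <= s -> s <= 1 -> h s <= exp_coeff s k) ->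
  (forall s : R, 0 <= s -> s <= 1 -> `|h s - h' s| <= a * exp_coeff s k) ->
  `|volterra F h x - volterra F' h' x| <= (a + 2 * D) * exp_coeff x k.+1.
Proof.
move=> hm h'm x0 x1 hk hh'.
rewrite /volterra -RintegralB//; last 2 first.
- exact: volterra_integrable.
- exact: volterra_integrable.
apply: Rintegral_norm_le_exp_coeff => //.
  by apply: measurable_funB; exact: volterra_measurable.
move=> s s0 sx; have s1 := le_trans sx x1.
have -> : h s * (F x - F s) - h' s * (F' x - F' s) =
  (h s - h' s) * (F' x - F' s) + h s * ((F x - F' x) - (F s - F' s)) by ring.
rewrite [leRHS]mulrDl (le_trans (ler_normD _ _))// lerD//.
  rewrite normrM -[leRHS]mulr1 ler_pM ?hh'//.
  exact: monotone01_increment_le1.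
rewrite normrM mulrC ler_pM ?hk//.
  by rewrite (le_trans (ler_normB _ _))// mulr_natl mulr2n lerD// FD.
by rewrite ger0_norm ?hk// monotone01_ge0.
Qed.

(** A sharper estimate for the first step, where the argument is [F] itself and
    already differs from [F'] by [D]: the generic estimate would give [3 * D].
    The constant [2 * D] here is what makes the bound on the derivative of
    [gcosh] come out with [z ^+ 2] and not [z ^+ 2 * expR (z ^+ 2)]. *)
Lemma volterra_self_dist x : 0 <= x -> x <= 1 ->
  `|volterra F F x - volterra F' F' x| <= 2 * D * exp_coeff x 1.
Proof.
move=> x0 x1; rewrite /volterra -RintegralB//; last 2 first.
- exact: volterra_integrable.
- exact: volterra_integrable.
apply: Rintegral_norm_le_exp_coeff => //.
  by apply: measurable_funB; exact: volterra_measurable.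
move=> s s0 sx; have s1 := le_trans sx x1.
rewrite /exp_coeff/= expr0 divr1 mulr1.
(* The two asymmetric product rules are averaged. *)
set Hx := (F x + F' x) / 2; set Hs := (F s + F' s) / 2.
have -> : F s * (F x - F s) - F' s * (F' x - F' s) =
  (F s - F' s) * (Hx - 2 * Hs) + (F x - F' x) * Hs by rewrite /Hx /Hs; field.
have Hs0 : 0 <= Hs.
  have := monotone01_ge0 Fm s0 s1; have := monotone01_ge0 F'm s0 s1.
  by rewrite /Hs; lra.
have Hsx : Hs <= Hx.
  by have := Fm.2 _ _ s0 sx x1; have := F'm.2 _ _ s0 sx x1; rewrite /Hx /Hs; lra.
have Hx1 : Hx <= 1.
  have := monotone01_le1 Fm F1 x0 x1; have := monotone01_le1 F'm F'1 x0 x1.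
  by rewrite /Hx; lra.
have D0 : 0 <= D by apply: le_trans (FD x0 x1).
clearbody Hx Hs.
rewrite (le_trans (ler_normD _ _))// !normrM (ger0_norm Hs0).
apply: (@le_trans _ _ (D * `|Hx - 2 * Hs| + D * Hs)).
  by rewrite lerD// ler_wpM2r// FD.
rewrite -mulrDr mulrC ler_wpM2r//.
by case: (ler0P (Hx - 2 * Hs)); lra.
Qed.

End perturbation.
End volterra.

(** * Bounds and distances for the iterated integrals *)

Lemma odd_double_succ (k : nat) : odd (2 * k).+1.
Proof. by rewrite oddS oddM. Qed.

Lemma even_double_succ (k : nat) : ~~ odd (2 * k).+2.
Proof. by rewrite !oddS oddM. Qed.

Section one_measure.
Variables (R : realType) (nu : probability (measurableTypeR R) R).
Notation F := (distribution_function nu).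

Lemma hyp_p_evenS (k : nat) (x : R) :
  hyp_p nu (2 * k.+1) x = \int[leb]_(t in `[0, x]) hyp_p nu (2 * k).+1 t.
Proof. by rewrite mulnS add2n hyp_p_evenE ?even_double_succ. Qed.

Lemma hyp_q_oddS (k : nat) (x : R) :
  hyp_q nu (2 * k).+1 x = \int[leb]_(t in `[0, x]) hyp_q nu (2 * k) t.
Proof. by rewrite hyp_q_oddE ?odd_double_succ. Qed.

Hypothesis nu_na : nonatomic nu.

Lemma hyp_p_odd_volterra (k : nat) (x : R) : x <= 1 ->
  hyp_p nu (2 * k.+1).+1 x = volterra F (hyp_p nu (2 * k).+1) x.
Proof.
move=> x1; rewrite hyp_p_oddE; last exact: odd_double_succ.
rewrite /volterra -primitive_by_parts//; last exact: hyp_p_monotone.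
by apply: eq_Rintegral => t _; exact: hyp_p_evenS.
Qed.

Lemma hyp_q_even_volterra (k : nat) (x : R) : x <= 1 ->
  hyp_q nu (2 * k.+1) x = volterra F (hyp_q nu (2 * k)) x.
Proof.
move=> x1; rewrite mulnS add2n hyp_q_evenE; last exact: even_double_succ.
rewrite /volterra -primitive_by_parts//; last exact: hyp_q_monotone.
by apply: eq_Rintegral => t _; exact: hyp_q_oddS.
Qed.

Lemma hyp_p_odd_le (k : nat) (x : R) : 0 <= x -> x <= 1 ->
  hyp_p nu (2 * k).+1 x <= exp_coeff x k.
Proof.
elim: k x => [|k IH] x x0 x1.
  rewrite muln0 -distribution_hyp_p /exp_coeff/= expr0 divr1.
  exact: distribution_le1.
rewrite hyp_p_odd_volterra//; apply: volterra_le => //.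
- exact: distribution_monotone.
- exact: distribution_le1.
- exact: hyp_p_monotone.
Qed.

Lemma hyp_q_even_le (k : nat) (x : R) : 0 <= x -> x <= 1 ->
  hyp_q nu (2 * k) x <= exp_coeff x k.
Proof.
elim: k x => [|k IH] x x0 x1.
  by rewrite muln0 /exp_coeff/= expr0 divr1.
rewrite hyp_q_even_volterra//; apply: volterra_le => //.
- exact: distribution_monotone.
- exact: distribution_le1.
- exact: hyp_q_monotone.
Qed.

Lemma hyp_p_even_le (k : nat) (x : R) : 0 <= x -> x <= 1 ->
  hyp_p nu (2 * k) x <= exp_coeff x k.
Proof.
case: k => [|k] x0 x1; first by rewrite muln0 /exp_coeff/= expr0 divr1.
rewrite hyp_p_evenS; apply: monotone01_primitive_le => //.
  exact: hyp_p_monotone.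
by move=> s s0 s1; exact: hyp_p_odd_le.
Qed.

Lemma hyp_q_odd_le (k : nat) (x : R) : 0 <= x -> x <= 1 ->
  hyp_q nu (2 * k).+1 x <= exp_coeff x k.+1.
Proof.
move=> x0 x1; rewrite hyp_q_oddS; apply: monotone01_primitive_le => //.
  exact: hyp_q_monotone.
by move=> s s0 s1; exact: hyp_q_even_le.
Qed.

Lemma hyp_p_odd_increment (k : nat) (x y : R) : 0 <= x -> x <= y -> y <= 1 ->
  hyp_p nu (2 * k).+1 y - hyp_p nu (2 * k).+1 x <= k`!%:R^-1 * (F y - F x).
Proof.
move=> x0 xy y1; have y0 := le_trans x0 xy.
rewrite (hyp_p_oddE nu (odd_double_succ k)).
have /andP[_] :=
  monotone01_increment (prob_fin01 nu) (hyp_p_monotone nu (2 * k)) x0 xy y1.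
move=> /le_trans; apply; rewrite -distribution_increment// ler_wpM2r//.
  by rewrite subr_ge0 (distribution_monotone nu).2.
exact: le_trans (hyp_p_even_le k y0 y1) (exp_coeff_le k y0 y1).
Qed.

Lemma hyp_p_even_increment (k : nat) (x y : R) : 0 <= x -> x <= y -> y <= 1 ->
  hyp_p nu (2 * k).+1 x * (y - x)
    <= hyp_p nu (2 * k.+1) y - hyp_p nu (2 * k.+1) x
    <= hyp_p nu (2 * k).+1 y * (y - x).
Proof.
move=> x0 xy y1; rewrite !hyp_p_evenS.
have := monotone01_increment (lebesgue_fin01 R) (hyp_p_monotone nu (2 * k).+1) x0 xy y1.
suff -> : fine (@lebesgue_measure R `]x, y]%classic) = y - x by [].
rewrite lebesgue_measure_itv/= lte_fin; case: ltP => [_|yx]//=.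
by apply/esym/eqP; rewrite subr_eq0 eq_le yx.
Qed.

End one_measure.

Section two_measures.
Variables (R : realType) (nu nu' : probability (measurableTypeR R) R) (D : R).
Notation F := (distribution_function nu).
Notation F' := (distribution_function nu').
Hypotheses (nu_na : nonatomic nu) (nu'_na : nonatomic nu').
Hypothesis FD : forall x : R, 0 <= x -> x <= 1 -> `|F x - F' x| <= D.

Let D_ge0 : 0 <= D.
Proof. by apply: le_trans (FD (lexx 0) ler01). Qed.

(** The recursion starts from [hyp_p 3], where the sharp first step applies. *)
Lemma hyp_p_odd_dist (k : nat) (x : R) : 0 <= x -> x <= 1 ->
  `|hyp_p nu (2 * k.+1).+1 x - hyp_p nu' (2 * k.+1).+1 x|
    <= (2 * k.+1%:R * D) * exp_coeff x k.+1.
Proof.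
elim: k x => [|k IH] x x0 x1.
  rewrite !hyp_p_odd_volterra// !muln0 -!distribution_hyp_p mulr1.
  by apply: volterra_self_dist; rewrite ?distribution_le1//;
    exact: distribution_monotone.
rewrite (@hyp_p_odd_volterra _ nu)// (@hyp_p_odd_volterra _ nu')//.
rewrite (_ : 2 * k.+2%:R * D = 2 * k.+1%:R * D + 2 * D); last first.
  by rewrite -[in LHS]nat1r; ring.
apply: volterra_dist; rewrite ?distribution_le1//.
- exact: distribution_monotone.
- exact: distribution_monotone.
- exact: hyp_p_monotone.
- exact: hyp_p_monotone.
- by move=> s s0 s1; exact: hyp_p_odd_le.
Qed.

Lemma hyp_p1_dist (x : R) : 0 <= x -> x <= 1 ->
  `|hyp_p nu 1 x - hyp_p nu' 1 x| <= D.
Proof. by move=> x0 x1; rewrite -!distribution_hyp_p FD. Qed.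

Lemma hyp_q_even_dist (k : nat) (x : R) : 0 <= x -> x <= 1 ->
  `|hyp_q nu (2 * k) x - hyp_q nu' (2 * k) x|
    <= (2 * k%:R * D) * exp_coeff x k.
Proof.
elim: k x => [|k IH] x x0 x1.
  by rewrite muln0 subrr normr0 mulr0 !mul0r.
rewrite (@hyp_q_even_volterra _ nu)// (@hyp_q_even_volterra _ nu')//.
rewrite (_ : 2 * k.+1%:R * D = 2 * k%:R * D + 2 * D); last first.
  by rewrite -[in LHS]nat1r; ring.
apply: volterra_dist; rewrite ?distribution_le1//.
- exact: distribution_monotone.
- exact: distribution_monotone.
- exact: hyp_q_monotone.
- exact: hyp_q_monotone.
- by move=> s s0 s1; exact: hyp_q_even_le.
Qed.

Lemma hyp_p_even_dist (k : nat) (x : R) : 0 <= x -> x <= 1 ->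
  `|hyp_p nu (2 * k.+1) x - hyp_p nu' (2 * k.+1) x| <= 2 * D / k`!%:R.
Proof.
move=> x0 x1; rewrite !hyp_p_evenS.
have /le_trans : `|\int[leb]_(t in `[0, x]) hyp_p nu (2 * k).+1 t -
   \int[leb]_(t in `[0, x]) hyp_p nu' (2 * k).+1 t| <=
   (2 * D * k.+1%:R) * exp_coeff x k.+1.
  apply: primitive_dist => //; [exact: hyp_p_monotone|exact: hyp_p_monotone|].
  move=> s s0 s1; case: k => [|k].
    rewrite /exp_coeff/= expr0 divr1 !mulr1 (le_trans (hyp_p1_dist s0 s1))//.
    by rewrite mulr2n mulrDl mul1r lerDl.
  rewrite (le_trans (hyp_p_odd_dist k s0 s1))//.
  rewrite ler_wpM2r ?exp_coeff_ge0// -mulrA (mulrC _ D) mulrA ler_wpM2l ?mulr_ge0//.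
  by rewrite ler_nat.
apply; rewrite -mulrA ler_wpM2l ?mulr_ge0// exp_coeffS.
by rewrite -[leRHS]mul1r ler_pM ?exp_coeff_ge0// exp_coeff_le.
Qed.

Lemma hyp_q_odd_dist (k : nat) (x : R) : 0 <= x -> x <= 1 ->
  `|hyp_q nu (2 * k.+1).+1 x - hyp_q nu' (2 * k.+1).+1 x| <= 2 * D / k`!%:R.
Proof.
move=> x0 x1; rewrite !hyp_q_oddS.
have /le_trans : `|\int[leb]_(t in `[0, x]) hyp_q nu (2 * k.+1) t -
   \int[leb]_(t in `[0, x]) hyp_q nu' (2 * k.+1) t| <=
   (2 * k.+1%:R * D) * exp_coeff x k.+2.
  apply: primitive_dist => //; [exact: hyp_q_monotone|exact: hyp_q_monotone|].
  by move=> s s0 s1; exact: hyp_q_even_dist.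
apply; rewrite (mulrAC 2 _ D) -(mulrA (2 * D)) ler_wpM2l ?mulr_ge0//.
apply: (@le_trans _ _ (k.+2%:R * exp_coeff x k.+2)).
  by rewrite ler_wpM2r ?exp_coeff_ge0// ler_nat.
rewrite exp_coeffS -[leRHS]mul1r ler_pM ?exp_coeff_ge0//.
rewrite (le_trans (exp_coeff_le _ x0 x1))//.
by rewrite lef_pV2 ?posrE ?ltr0n ?fact_gt0// ler_nat factS leq_pmull.
Qed.

End two_measures.

(** * Series and the derivative of the hyperbolic cosine *)

Section series.
Variable R : realType.
Implicit Types (u v w : R ^nat) (r : R).

Lemma cvg_exp_dominated u (c r : R) :
  (forall k, `|u k| <= c * exp_coeff r k) -> cvgn (series u).
Proof.
move=> uc; apply: normed_cvg.
apply: (@series_le_cvg _ _ (c *: exp_coeff r)) => [k|k|k|]; rewrite /= ?normr_ge0//.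
- exact: le_trans (uc k).
- by apply: is_cvg_seriesZ; exact: is_cvg_series_exp_coeff.
Qed.

Lemma lim_series_scaled_le u v w (c : R) :
  cvgn (series u) -> cvgn (series v) -> cvgn (series w) ->
  (forall k, u k - v k <= c * w k) ->
  limn (series u) - limn (series v) <= c * limn (series w).
Proof.
move=> cu cv cw uvw.
rewrite -[leRHS](lim_seriesZ c cw) -lim_seriesB//; apply: lim_series_le => //.
- exact: is_cvg_seriesB.
- exact: is_cvg_seriesZ.
Qed.

Lemma lim_series_scaled_ge u v w (c : R) :
  cvgn (series u) -> cvgn (series v) -> cvgn (series w) ->
  (forall k, c * w k <= u k - v k) ->
  c * limn (series w) <= limn (series u) - limn (series v).
Proof.
move=> cu cv cw uvw.
rewrite -[leLHS](lim_seriesZ c cw) -lim_seriesB//; apply: lim_series_le => //.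
- exact: is_cvg_seriesZ.
- exact: is_cvg_seriesB.
Qed.

Lemma lim_series_recl u : cvgn (series u) ->
  cvgn (series (fun k => u k.+1)) /\
  limn (series u) = u 0%N + limn (series (fun k => u k.+1)).
Proof.
move=> cu.
have uS : series (fun k => u k.+1) = (fun n => series u n.+1 - u 0%N).
  apply/funext => n; rewrite /series/= [X in _ = X - _]big_nat_recl//=.
  by rewrite addrAC subrr add0r.
have : series (fun k => u k.+1) @ \oo --> limn (series u) - u 0%N.
  by rewrite uS; apply: cvgB; [rewrite cvg_shiftS; exact: cu|exact: cvg_cst].
move=> H; split; first by apply/cvg_ex; eexists; exact: H.
by rewrite (cvg_lim _ H)// addrC subrK.
Qed.

(** The form in which the coefficient estimates are summed; the term of index 0 is
    treated apart. *)
Lemma lim_series_dist u v (a b r : R) :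
  cvgn (series u) -> cvgn (series v) ->
  `|u 0%N - v 0%N| <= a ->
  (forall k, `|u k.+1 - v k.+1| <= b * exp_coeff r k) ->
  `|limn (series u) - limn (series v)| <= a + b * expR r.
Proof.
move=> cu cv uva uvb.
have [cu' ->] := lim_series_recl cu; have [cv' ->] := lim_series_recl cv.
rewrite opprD addrACA (le_trans (ler_normD _ _))// lerD//.
have ce : cvgn (series (exp_coeff r)) by exact: is_cvg_series_exp_coeff.
rewrite ler_norml lerNl opprB.
apply/andP; split.
  apply: (lim_series_scaled_le cv' cu' ce) => k.
  by apply: le_trans (uvb k); rewrite distrC ler_norm.
apply: (lim_series_scaled_le cu' cv' ce) => k.
by apply: le_trans (uvb k); rewrite ler_norm.
Qed.

End series.

Section gcosh_derivative.
Variables (R : realType) (nu : probability (measurableTypeR R) R) (z : R).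
Notation F := (distribution_function nu).

(** The termwise derivative of [gcosh]: the derivative of [hyp_p (2 * k.+1)] is
    [hyp_p (2 * k).+1], and the constant term disappears. *)
Definition gcosh_deriv (x : R) : R :=
  limn (series (fun k : nat => z ^+ (2 * k.+1) * hyp_p nu (2 * k).+1 x)).

Hypothesis nu_na : nonatomic nu.

Let zz_ge0 (k : nat) : 0 <= z ^+ 2 ^+ k.
Proof. exact: exprn_ge0 (sqr_ge0 z). Qed.

Lemma cvg_gcosh (x : R) : 0 <= x -> x <= 1 ->
  cvgn (series (fun k : nat => z ^+ (2 * k) * hyp_p nu (2 * k) x)).
Proof.
move=> x0 x1; apply: (@cvg_exp_dominated _ _ 1 (z ^+ 2)) => k.
rewrite mul1r exprM normrM ger0_norm ?zz_ge0//.
rewrite ler_wpM2l ?zz_ge0// ger0_norm.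
  exact: le_trans (hyp_p_even_le _ _ _ _) (exp_coeff_le _ _ _).
exact: monotone01_ge0 (hyp_p_monotone nu _) _ _.
Qed.

Lemma cvg_gcosh_deriv (x : R) : 0 <= x -> x <= 1 ->
  cvgn (series (fun k : nat => z ^+ (2 * k.+1) * hyp_p nu (2 * k).+1 x)).
Proof.
move=> x0 x1; apply: (@cvg_exp_dominated _ _ (z ^+ 2) (z ^+ 2)) => k.
rewrite exprM exprS -mulrA normrM ger0_norm ?sqr_ge0//.
rewrite ler_wpM2l ?sqr_ge0// normrM ger0_norm ?zz_ge0//.
rewrite ler_wpM2l ?zz_ge0// ger0_norm.
  exact: le_trans (hyp_p_odd_le _ _ _ _) (exp_coeff_le _ _ _).
exact: monotone01_ge0 (hyp_p_monotone nu _) _ _.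
Qed.

Lemma cvg_gsinh (x : R) : 0 <= x -> x <= 1 ->
  cvgn (series (fun k : nat => z ^+ (2 * k + 1) * hyp_q nu (2 * k + 1) x)).
Proof.
move=> x0 x1; apply: (@cvg_exp_dominated _ _ `|z| (z ^+ 2)) => k.
rewrite addn1 exprS exprM -mulrA normrM ler_wpM2l//.
rewrite normrM ger0_norm ?zz_ge0//.
rewrite ler_wpM2l ?zz_ge0// ger0_norm.
  apply: le_trans (hyp_q_odd_le _ _ _ _) _ => //.
  rewrite (le_trans (exp_coeff_le _ x0 x1))//.
  by rewrite lef_pV2 ?posrE ?ltr0n ?fact_gt0// ler_nat factS leq_pmull.
exact: monotone01_ge0 (hyp_q_monotone nu _) _ _.
Qed.

Lemma gcosh_recl (x : R) : 0 <= x -> x <= 1 ->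
  let tail := series (fun k : nat => z ^+ (2 * k.+1) * hyp_p nu (2 * k.+1) x) in
  cvgn tail /\ gcosh nu z x = 1 + limn tail.
Proof.
move=> x0 x1 tail; rewrite /gcosh; have [ct ->] := lim_series_recl (cvg_gcosh x0 x1).
by split; [exact: ct|rewrite muln0 expr0 mul1r].
Qed.

(** Since [gcosh_deriv] is a sum of nondecreasing functions, this sandwich
    replaces an exchange of sum and integral. *)
Lemma gcosh_increment (x y : R) : 0 <= x -> x <= y -> y <= 1 ->
  (y - x) * gcosh_deriv x <= gcosh nu z y - gcosh nu z x
    <= (y - x) * gcosh_deriv y.
Proof.
move=> x0 xy y1; have y0 := le_trans x0 xy; have x1 := le_trans xy y1.
have [cx ->] := gcosh_recl x0 x1; have [cy ->] := gcosh_recl y0 y1.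
rewrite opprD addrACA subrr add0r.
have zz k : 0 <= z ^+ (2 * k) by rewrite exprM zz_ge0.
have H k := hyp_p_even_increment nu k x0 xy y1.
apply/andP; split.
  apply: lim_series_scaled_ge => [|||k].
  - exact: cy.
  - exact: cx.
  - exact: cvg_gcosh_deriv.
  have /andP[Hk _] := H k.
  by rewrite -mulrBr mulrCA (mulrC (y - x)) (ler_wpM2l (zz _) Hk).
apply: lim_series_scaled_le => [|||k].
- exact: cy.
- exact: cx.
- exact: cvg_gcosh_deriv.
have /andP[_ Hk] := H k.
by rewrite -mulrBr mulrCA (mulrC (y - x)) (ler_wpM2l (zz _) Hk).
Qed.

(** The modulus of continuity of [gcosh_deriv] is controlled by that of [F]. *)
Lemma gcosh_deriv_increment (x y : R) : 0 <= x -> x <= y -> y <= 1 ->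
  gcosh_deriv y - gcosh_deriv x <= (F y - F x) * (z ^+ 2 * expR (z ^+ 2)).
Proof.
move=> x0 xy y1; have y0 := le_trans x0 xy; have x1 := le_trans xy y1.
rewrite mulrA; apply: lim_series_scaled_le.
- exact: cvg_gcosh_deriv.
- exact: cvg_gcosh_deriv.
- exact: is_cvg_series_exp_coeff.
move=> k; rewrite -mulrBr exprM exprS /exp_coeff [leRHS]/=.
have := hyp_p_odd_increment nu_na k x0 xy y1.
move: (z ^+ 2) (sqr_ge0 z) (zz_ge0 k) => w w0 wk Hk.
by rewrite -!mulrA [leRHS]mulrCA ler_wpM2l// [leRHS]mulrCA ler_wpM2l// mulrC.
Qed.

Lemma distribution_continuous01 (x e : R) : 0 <= x -> x <= 1 -> 0 < e ->
  exists2 d, 0 < d & forall y : R, 0 <= y -> y <= 1 -> `|y - x| < d ->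
    `|F y - F x| <= e.
Proof.
move=> x0 x1 e0.
pose A n : set (measurableTypeR R) := `[x - n.+1%:R^-1, x + n.+1%:R^-1]%classic.
have mA n : measurable (A n) by exact: measurable_itv.
have A1 : \bigcap_n A n = [set x].
  apply/seteqP; split => [t At|_ -> n _]; last first.
    by rewrite /A/= in_itv/= lerDl gerBl invr_ge0 ler0n.
  apply/eqP; rewrite /= -subr_eq0 -normr_le0; apply/ler_addgt0Pl => d d0.
  rewrite addr0; pose n := Num.truncn d^-1.
  have : `|t - x| <= n.+1%:R^-1.
    by have := At n I; rewrite /A/= in_itv/= ler_distl.
  move=> /le_trans; apply; rewrite invf_ple ?posrE//.
  by rewrite ltW// truncnS_gt.
have niA : nonincreasing_seq A.
  move=> n m nm; apply/subsetPset => t; rewrite /A/= !in_itv/= => /andP[tl tr].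
  have : m.+1%:R^-1 <= n.+1%:R^-1 :> R by rewrite lef_pV2 ?posrE// ler_nat.
  move=> H; rewrite (le_trans _ tl) ?(le_trans tr)// ?lerD2l// lerN2//.
have : nu (A n) @[n --> \oo] --> 0%E.
  rewrite -(nonatomic_set1 x nu_na) -A1; apply: nonincreasing_cvg_mu => //.
    by rewrite (le_lt_trans (probability_le1 _ _)) ?ltry.
  by rewrite A1; exact: measurable_set1.
move/fine_cvgP.
move=> [_ /cvgrPdist_le/(_ _ e0)[N _ /(_ N (leqnn N))]].
rewrite sub0r normrN ger0_norm ?fine_ge0//= => nuA.
exists N.+1%:R^-1; first by rewrite invr_gt0.
suff H s t : 0 <= s -> s <= t -> t <= 1 -> A N s -> A N t -> `|F t - F s| <= e.
  move=> y y0 y1 yx.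
  have AN w : `|w - x| <= N.+1%:R^-1 -> A N w.
    by rewrite ler_distl /A/= in_itv.
  have Ax : A N x by apply: AN; rewrite subrr normr0 invr_ge0.
  have Ay : A N y by apply: AN; exact: ltW.
  by have [xy|/ltW yx'] := leP x y; [|rewrite distrC]; exact: H.
move=> s0 st t1 As At; rewrite distribution_increment// ger0_norm ?fine_ge0//.
apply: le_trans nuA; rewrite fine_le ?fin_num_measure//.
apply: le_measure; rewrite ?inE//.
move: As At; rewrite /A/= !in_itv/= => /andP[As _] /andP[_ At] w.
rewrite !/= !in_itv/= => /andP[sw wt].
by rewrite (le_trans As (ltW sw)) (le_trans wt At).
Qed.

End gcosh_derivative.

(** Every point of [0, 1], endpoints included, is a limit point of [0, 1]. *)
Lemma proper_within01_dnbhs (R : realType) (x : R) : 0 <= x -> x <= 1 ->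
  ProperFilter (within `[0, 1]%classic x^').
Proof.
move=> x0 x1; apply: Build_ProperFilter_ex => P.
rewrite /within/= /dnbhs/= /within/= => /nbhs_ballP[e /= e0 eP].
have [y [y0 y1 yx yne]] : exists y, [/\ 0 <= y, y <= 1, `|x - y| < e & y != x].
  have e2 : e / 2 < e by lra.
  have [xlt1|] := ltP x 1.
    exists (Num.min (x + e / 2) 1).
    have xm : x < Num.min (x + e / 2) 1 by rewrite lt_min xlt1 ltrDl divr_gt0.
    split; [exact: le_trans (ltW xm)|by rewrite ge_min lexx orbT| |by rewrite gt_eqF].
    rewrite distrC gtr0_norm ?subr_gt0// ltrBlDl gt_min.
    by rewrite ltrD2l e2.
  move=> x1'; have {x1 x1' x0}-> : x = 1 by apply/eqP; rewrite eq_le x1.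
  exists (Num.max (1 - e / 2) 0).
  have xm : Num.max (1 - e / 2) 0 < 1 by rewrite gt_max ltr01 gtrBl divr_gt0.
  split; [by rewrite le_max lexx orbT|exact: ltW| |by rewrite lt_eqF].
  rewrite gtr0_norm ?subr_gt0// ltrBlDl -ltrBlDr lt_max.
  by rewrite ltrD2l ltrN2 e2.
exists y; apply: (eP y yx yne); by rewrite /= in_itv/= y0.
Qed.

Lemma derive01_gcosh (R : realType) (nu : probability (measurableTypeR R) R)
  (z x : R) : nonatomic nu -> 0 <= x -> x <= 1 ->
  derive01 (gcosh nu z) x = gcosh_deriv nu z x.
Proof.
move=> na x0 x1; have PF := proper_within01_dnbhs x0 x1.
apply: cvg_lim => //; apply/cvgrPdist_le => e e0.
pose C := z ^+ 2 * expR (z ^+ 2).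
have C0 : 0 <= C by rewrite mulr_ge0 ?sqr_ge0 ?expR_ge0.
have C1 : 0 < C + 1 by rewrite ltr_wpDl.
have [d d0 dP] := distribution_continuous01 na x0 x1 (divr_gt0 e0 C1).
rewrite near_withinE near_withinE; apply/nbhs_ballP; exists d => //= y.
rewrite /ball/= distrC => yd /eqP ynx; rewrite in_itv/= => /andP[y0 y1].
have FyFx := dP y y0 y1 yd.
suff H : `|gcosh_deriv nu z x - (gcosh nu z y - gcosh nu z x) / (y - x)|
    <= `|distribution_function nu y - distribution_function nu x| * C.
  apply: (le_trans H); rewrite -[leRHS](divfK (lt0r_neq0 C1)).
  by rewrite ler_pM// lerDl.
have [xy|] := ltP x y.
  have /andP[Sx Sy] := gcosh_increment z na x0 (ltW xy) y1.
  have yx0 : 0 < y - x by rewrite subr_gt0.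
  move: Sx Sy; rewrite mulrC -ler_pdivlMr// => Sx.
  rewrite mulrC -ler_pdivrMr// => Sy.
  rewrite distrC ger0_norm ?subr_ge0//.
  rewrite (le_trans (lerB Sy (lexx _)))//.
  rewrite (le_trans (gcosh_deriv_increment z na x0 (ltW xy) y1))//.
  by rewrite ler_wpM2r// ler_norm.
rewrite le_eqVlt => /predU1P[yx|yx]; first by rewrite yx in ynx.
have /andP[Sy Sx] := gcosh_increment z na y0 (ltW yx) x1.
have xy0 : 0 < x - y by rewrite subr_gt0.
have -> : (gcosh nu z y - gcosh nu z x) / (y - x)
    = (gcosh nu z x - gcosh nu z y) / (x - y).
  by rewrite -[in LHS](opprB x) invrN mulrN -mulNr opprB.
move: Sy Sx; rewrite mulrC -ler_pdivlMr// => Sy.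
rewrite mulrC -ler_pdivrMr// => Sx.
rewrite ger0_norm ?subr_ge0//.
rewrite (le_trans (lerB (lexx _) Sy))//.
rewrite (le_trans (gcosh_deriv_increment z na y0 (ltW yx) x1))//.
by rewrite ler_wpM2r// distrC ler_norm.
Qed.

(** * Distances between the generalized hyperbolic functions *)

Section sup_norm.
Variable R : realType.

Lemma sup_norm01_le (f : R -> R) (c : R) :
  (forall x : R, 0 <= x -> x <= 1 -> `|f x| <= c) -> (sup_norm01 f <= c%:E)%E.
Proof.
move=> fc; apply: ge_ereal_sup => _ [x + <-].
by rewrite /= in_itv/= lee_fin => /andP[x0 x1]; exact: fc.
Qed.

Lemma sup_norm01_fin (f : R -> R) (c : R) :
  (forall x : R, 0 <= x -> x <= 1 -> `|f x| <= c) ->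
  exists2 D, sup_norm01 f = D%:E &
    forall x : R, 0 <= x -> x <= 1 -> `|f x| <= D.
Proof.
move=> fc.
have fD (x : R) : 0 <= x -> x <= 1 -> (`|f x|%:E <= sup_norm01 f)%E.
  move=> x0 x1; apply: ereal_sup_ubound; exists x => //.
  by rewrite /= in_itv/= x0.
have ffin : sup_norm01 f \is a fin_num.
  rewrite ge0_fin_numE; first exact: le_lt_trans (sup_norm01_le fc) (ltry _).
  by apply: le_trans (fD _ (lexx 0) ler01); rewrite lee_fin.
exists (fine (sup_norm01 f)); first by rewrite fineK.
by move=> x x0 x1; rewrite -lee_fin fineK// fD.
Qed.

End sup_norm.

Section distances.
Variables (R : realType) (nu nu' : probability (measurableTypeR R) R) (D z : R).
Notation F := (distribution_function nu).
Notation F' := (distribution_function nu').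
Hypotheses (nu_na : nonatomic nu) (nu'_na : nonatomic nu').
Hypothesis FD : forall x : R, 0 <= x -> x <= 1 -> `|F x - F' x| <= D.

Lemma gcosh_dist (x : R) : 0 <= x -> x <= 1 ->
  `|gcosh nu z x - gcosh nu' z x| <= 2 * z ^+ 2 * expR (z ^+ 2) * D.
Proof.
move=> x0 x1.
have -> : 2 * z ^+ 2 * expR (z ^+ 2) * D = 0 + 2 * z ^+ 2 * D * expR (z ^+ 2).
  by ring.
apply: lim_series_dist => [|||k].
- exact: cvg_gcosh.
- exact: cvg_gcosh.
- by rewrite muln0 subrr normr0.
rewrite -mulrBr normrM exprM exprS /exp_coeff [leRHS]/=.
have := hyp_p_even_dist nu_na nu'_na FD k x0 x1.
have wk : 0 <= z ^+ 2 ^+ k by exact: exprn_ge0 (sqr_ge0 z).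
move: (z ^+ 2) (sqr_ge0 z) wk => w w0 wk Hk.
rewrite ger0_norm ?mulr_ge0//.
have -> : 2 * w * D * (w ^+ k / k`!%:R) = w * w ^+ k * (2 * D / k`!%:R) by ring.
by rewrite ler_wpM2l// mulr_ge0.
Qed.

Lemma gcosh_deriv_dist (x : R) : 0 <= x -> x <= 1 ->
  `|gcosh_deriv nu z x - gcosh_deriv nu' z x|
    <= (z ^+ 2 + 2 * z ^+ 4 * expR (z ^+ 2)) * D.
Proof.
move=> x0 x1; have D0 : 0 <= D by apply: le_trans (FD x0 x1).
have -> : (z ^+ 2 + 2 * z ^+ 4 * expR (z ^+ 2)) * D =
  z ^+ 2 * D + 2 * z ^+ 4 * D * expR (z ^+ 2) by ring.
apply: lim_series_dist => [|||k].
- exact: cvg_gcosh_deriv.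
- exact: cvg_gcosh_deriv.
- rewrite muln1 muln0 -mulrBr normrM ger0_norm ?sqr_ge0//.
  by rewrite ler_wpM2l ?sqr_ge0//; exact: hyp_p1_dist.
rewrite -mulrBr normrM !mulnS exprD exprD (exprM z 2 k) /exp_coeff [leRHS]/=.
have := hyp_p_odd_dist nu_na nu'_na FD k x0 x1; rewrite mulnS.
have wk : 0 <= z ^+ 2 ^+ k by exact: exprn_ge0 (sqr_ge0 z).
have -> : z ^+ 4 = z ^+ 2 * z ^+ 2 by rewrite -exprD.
move: (z ^+ 2) (sqr_ge0 z) wk => w w0 wk Hk.
rewrite ger0_norm ?mulr_ge0//.
have -> : 2 * (w * w) * D * (w ^+ k / k`!%:R) =
  w * (w * w ^+ k) * (2 * D / k`!%:R) by ring.
rewrite ler_wpM2l ?mulr_ge0//; apply: (le_trans Hk).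
rewrite (mulrAC 2 _ D) -(mulrA (2 * D)) exp_coeffS ler_wpM2l ?mulr_ge0//.
by rewrite -[leRHS]mul1r ler_pM ?exp_coeff_ge0// exp_coeff_le.
Qed.

Lemma gsinh_dist (x : R) : 0 <= x -> x <= 1 ->
  `|gsinh nu z x - gsinh nu' z x| <= 2 * `|z| ^+ 3 * expR (z ^+ 2) * D.
Proof.
move=> x0 x1.
have -> : 2 * `|z| ^+ 3 * expR (z ^+ 2) * D =
  0 + 2 * `|z| ^+ 3 * D * expR (z ^+ 2) by ring.
apply: lim_series_dist => [|||k].
- exact: cvg_gsinh.
- exact: cvg_gsinh.
- by rewrite muln0 subrr normr0.
rewrite -mulrBr normrM addn1 /exp_coeff [leRHS]/=.
have := hyp_q_odd_dist nu_na nu'_na FD k x0 x1.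
rewrite normrX !mulnS exprS exprD exprM -(real_normK (num_real z)) (exprS `|z| 2).
have wk : 0 <= `|z| ^+ 2 ^+ k by exact: exprn_ge0 (sqr_ge0 _).
move: (`|z| ^+ 2) (sqr_ge0 `|z|) wk => w w0 wk Hk.
have -> : 2 * (`|z| * w) * D * (w ^+ k / k`!%:R) =
  `|z| * (w * w ^+ k) * (2 * D / k`!%:R) by ring.
by rewrite ler_wpM2l ?mulr_ge0.
Qed.

End distances.

Lemma distribution_dist_le1 (R : realType)
  (nu nu' : probability (measurableTypeR R) R) (x : R) : 0 <= x -> x <= 1 ->
  `|distribution_function nu x - distribution_function nu' x| <= 1.
Proof.
move=> x0 x1; rewrite ler_norml.
have := monotone01_ge0 (distribution_monotone nu) x0 x1.
have := monotone01_ge0 (distribution_monotone nu') x0 x1.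
have := distribution_le1 nu x; have := distribution_le1 nu' x.
by move=> *; apply/andP; split; lra.
Qed.

Unset Implicit Arguments.

Theorem lemma5p3 (R : realType)
    (mu : probability (measurableTypeR R) R)
    (mus : nat -> probability (measurableTypeR R) R)
    (mu01 : carried_by01 mu)
    (mu_na : nonatomic mu)
    (mu_supp0 : measure_support mu 0) (mu_supp1 : measure_support mu 1)
    (mus01 : forall n : nat, carried_by01 (mus n))
    (mus_na : forall n : nat, nonatomic (mus n))
    (mus_supp0 : forall n : nat, measure_support (mus n) 0)
    (mus_supp1 : forall n : nat, measure_support (mus n) 1)
    (mus_mu : weakly_converges01 mus mu)
    (z : R) (n : nat) :
  let normFFn := sup_norm01 (fun x : R =>
    distribution_function mu x - distribution_function (mus n) x) in
  [/\ (sup_norm01 (fun x : R => (gcosh mu z x - gcosh (mus n) z x)%R)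
        <= (2 * z ^+ 2 * expR (z ^+ 2))%:E * normFFn)%E,
      (sup_norm01 (fun x : R =>
          (derive01 (gcosh mu z) x - derive01 (gcosh (mus n) z) x)%R)
        <= (z ^+ 2 + 2 * z ^+ 4 * expR (z ^+ 2))%:E * normFFn)%E
    & (sup_norm01 (fun x : R => (gsinh mu z x - gsinh (mus n) z x)%R)
        <= (2 * `|z| ^+ 3 * expR (z ^+ 2))%:E * normFFn)%E].
Proof.
move=> normFFn.
have [D DE FD] := sup_norm01_fin (@distribution_dist_le1 _ mu (mus n)).
rewrite /normFFn DE -!EFinM; split; apply: sup_norm01_le => x x0 x1.
- exact: gcosh_dist.
- by rewrite !derive01_gcosh//; exact: gcosh_deriv_dist.
- exact: gsinh_dist.
Qed.
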